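(* Let $D\subseteq\mathbb{R}^d$, let $K:D\times D\to\mathbb{R}$ be a covariance function, let $\mathbf{x}^1,\dots,\mathbf{x}^n\in D$ be data points (not necessarily distinct), and let $\mathbf{C}=(K(\mathbf{x}^i,\mathbf{x}^j))_{1\le i,j\le n}$, which need not be invertible. Then the variance of the Gaussian process regularized by pseudoinverse is zero at the data points: $v^{PI}(\mathbf{x}^i)=0$ for all $i=1,\dots,n$.
   Context: A covariance function is a symmetric positive semidefinite kernel. For $\mathbf{x}\in D$, $\mathbf{c}(\mathbf{x})=(K(\mathbf{x},\mathbf{x}^1),\dots,K(\mathbf{x},\mathbf{x}^n))^\top$. The kriging covariance regularized by pseudoinverse is $c^{PI}(\mathbf{x},\mathbf{x}')=K(\mathbf{x},\mathbf{x}')-\mathbf{c}(\mathbf{x})^\top\mathbf{C}^\dagger\mathbf{c}(\mathbf{x}')$, where $\mathbf{C}^\dagger$ is the Moore–Penrose pseudoinverse of $\mathbf{C}$, and the corresponding kriging variance is $v^{PI}(\mathbf{x})=c^{PI}(\mathbf{x},\mathbf{x})$. *)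

(* Defs.v *)
(* MathComp / MathComp-Analysis *)
From mathcomp Require Import all_boot all_order all_algebra.
From mathcomp Require Import boolp classical_sets reals.

Set Implicit Arguments.
Unset Strict Implicit.
Unset Printing Implicit Defensive.

Import Order.TTheory GRing.Theory Num.Theory.
Local Open Scope ring_scope.

(* The evaluation points t are not required to be distinct. *)
Definition covariance_function (R : realType) (T : Type) (K : T -> T -> R) :
    Prop :=
  (forall x y : T, K x y = K y x) /\
  (forall (m : nat) (t : 'I_m -> T) (a : 'I_m -> R),
     0 <= \sum_(i < m) \sum_(j < m) a i * a j * K (t i) (t j)).

(* The four Penrose equations, over the reals. *)
Definition is_moore_penrose (R : realType) (m n : nat)
    (A : 'M[R]_(m, n)) (X : 'M[R]_(n, m)) : Prop :=
  [/\ A *m X *m A = A,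
      X *m A *m X = X,
      (A *m X)^T = A *m X
    & (X *m A)^T = X *m A].

(* MathComp's pinvmx is only a one-sided partial inverse, not the Moore-Penrose
   one. The default value 0 is never used, by moore_penroseP below. *)
Definition moore_penrose (R : realType) (m n : nat) (A : 'M[R]_(m, n)) :
    'M[R]_(n, m) :=
  xget 0 [set X | is_moore_penrose A X]%classic.

Lemma moore_penrose_unique (R : realType) (m n : nat) (A : 'M[R]_(m, n))
    (X Y : 'M[R]_(n, m)) :
  is_moore_penrose A X -> is_moore_penrose A Y -> X = Y.
Proof.
case=> AXA XAX AXs XAs [AYA YAY AYs YAs].
have AXY : A *m X = A *m Y.
  by rewrite -{1}AYA -[LHS]mulmxA -{1}AYs -AXs -trmx_mul mulmxA AXA AYs.
have XYA : X *m A = Y *m A.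
  by rewrite -{1}AYA !mulmxA -[LHS]mulmxA -{1}XAs -YAs -trmx_mul
    -mulmxA [A *m (X *m A)]mulmxA AXA YAs.
by rewrite -XAX XYA -mulmxA AXY mulmxA YAY.
Qed.

Lemma mulmx_tr_unit (R : realType) (r n : nat) (M : 'M[R]_(r, n)) :
  row_free M -> M *m M^T \in unitmx.
Proof.
move=> freeM; rewrite -row_free_unit -kermx_eq0; apply/eqP/row_matrixP => i.
rewrite row0; set u := row i _.
have uMM : u *m (M *m M^T) = 0 by rewrite /u -row_mul mulmx_ker row0.
have uM0 : (u *m M) *m (u *m M)^T = 0.
  by rewrite trmx_mul -[LHS]mulmxA [M *m (_ *m _)]mulmxA mulmxA uMM mul0mx.
have : u *m M = 0.
  apply/rowP => j; rewrite [RHS]mxE; apply/eqP.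
  move/matrixP/(_ 0 0)/eqP: uM0; rewrite [X in X == _]mxE [X in _ == X]mxE.
  rewrite psumr_eq0; last by move=> k _; rewrite [_^T _ _]mxE -expr2 sqr_ge0.
  by move/allP/(_ j (mem_index_enum j)); rewrite [_^T _ _]mxE -expr2 sqrf_eq0.
by move=> uM; apply: (row_free_inj freeM); rewrite uM mul0mx.
Qed.

Lemma moore_penrose_exists (R : realType) (m n : nat) (A : 'M[R]_(m, n)) :
  exists X, is_moore_penrose A X.
Proof.
have [r [B [F [AE uB uF]]]] : exists r (B : 'M[R]_(m, r)) (F : 'M[R]_(r, n)),
    [/\ A = B *m F, B^T *m B \in unitmx & F *m F^T \in unitmx].
  exists (\rank A), (col_base A), (row_base A); split.
  - by rewrite mulmx_base.
  - rewrite -{2}[col_base A]trmxK; apply: mulmx_tr_unit.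
    by rewrite /row_free mxrank_tr; exact: col_base_full.
  - exact/mulmx_tr_unit/row_base_free.
set IF := invmx (F *m F^T); set IB := invmx (B^T *m B).
have IFs : IF^T = IF by rewrite trmx_inv trmx_mul trmxK.
have IBs : IB^T = IB by rewrite trmx_inv trmx_mul trmxK.
set X := F^T *m IF *m IB *m B^T.
have AX : A *m X = B *m IB *m B^T.
  rewrite AE /X !mulmxA -[B *m F *m F^T]mulmxA.
  by rewrite -[B *m (F *m F^T) *m IF]mulmxA mulmxV // mulmx1.
have XA : X *m A = F^T *m IF *m F.
  rewrite AE /X !mulmxA -[_ *m B^T *m B]mulmxA.
  by rewrite -[_ *m IB *m _]mulmxA mulVmx // mulmx1.
exists X; split.
- by rewrite AX AE !mulmxA -[_ *m B^T *m B]mulmxA -[_ *m IB *m _]mulmxA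
    mulVmx // mulmx1.
- by rewrite XA /X !mulmxA -[_ *m F *m F^T]mulmxA -[_ *m IF *m (F *m F^T)]mulmxA
    mulVmx // mulmx1.
- by rewrite AX !trmx_mul trmxK IBs mulmxA.
- by rewrite XA !trmx_mul trmxK IFs mulmxA.
Qed.

Lemma moore_penroseP (R : realType) (m n : nat) (A : 'M[R]_(m, n)) :
  is_moore_penrose A (moore_penrose A).
Proof.
have [X AX] := moore_penrose_exists A.
exact: (@xgetPex _ 0 [set Y | is_moore_penrose A Y]%classic (ex_intro _ X AX)).
Qed.

Definition cov_matrix (R : realType) (T : Type) (K : T -> T -> R) (n : nat)
    (x : 'I_n -> T) : 'M[R]_n :=
  \matrix_(i < n, j < n) K (x i) (x j).

Definition cov_vector (R : realType) (T : Type) (K : T -> T -> R) (n : nat)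
    (x : 'I_n -> T) (t : T) : 'cV[R]_n :=
  \col_(i < n) K t (x i).

(* The entry (0, 0) turns the 1 x 1 matrix product into a scalar. *)
Definition kriging_cov_PI (R : realType) (T : Type) (K : T -> T -> R) (n : nat)
    (x : 'I_n -> T) (t t' : T) : R :=
  K t t' - ((cov_vector K x t)^T *m moore_penrose (cov_matrix K x)
              *m cov_vector K x t') 0 0.

Definition kriging_var_PI (R : realType) (T : Type) (K : T -> T -> R) (n : nat)
    (x : 'I_n -> T) (t : T) : R :=
  kriging_cov_PI K x t t.

(* Main.v *)
Require Import Defs.
From mathcomp Require Import all_boot all_order all_algebra.
From mathcomp Require Import boolp classical_sets reals.

Local Open Scope ring_scope.

(** By symmetry of K, the covariance vector c at the data point x i is both
    the i-th column and the transposed i-th row of the covariance matrix C.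
    Writing P for the pseudoinverse of C, the quadratic form c^T P c is therefore
    the (i, i) entry of C P C, which the Penrose equation C P C = C
    identifies with K (x i) (x i). *)

Theorem mainTheorem2 (R : realType) (d : nat) (D : set 'cV[R]_d)
    (K : D -> D -> R) (hK : covariance_function K)
    (n : nat) (x : 'I_n -> D) (i : 'I_n) :
  kriging_var_PI K x (x i) = 0.
Proof.
have [symK _] := hK; rewrite /kriging_var_PI /kriging_cov_PI.
set C := cov_matrix K x.
have [CPC _ _ _] := moore_penroseP C.
have c_row : (cov_vector K x (x i))^T = row i C.
  by apply/rowP => j; rewrite !mxE.
have c_col : cov_vector K x (x i) = col i C.
  by apply/colP => j; rewrite !mxE symK.
rewrite c_row c_col -row_mul colE mulmxA -row_mul CPC -colE !mxE.
exact: GRing.subrr.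
Qed.
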